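(* For every integer $b\ge 0$, the trinacria graph $T_{(b+2)b2}$ (that is, $T_{abc}$ with $a=b+2$ and $c=2$) is $e$-positive; that is, in the expansion of its chromatic symmetric function $X_{T_{(b+2)b2}}$ in the basis $\{e_\lambda\}$ of elementary symmetric functions, every coefficient is nonnegative.
   Context: For nonnegative integers $a,b,c$, the trinacria graph $T_{abc}$ is the graph on $a+b+c+3$ vertices obtained from a triangle with vertices $u_1,u_2,u_3$ by attaching the paths $P_a$, $P_b$, $P_c$ (on $a$, $b$, $c$ vertices) to $u_1,u_2,u_3$ respectively: one endpoint of $P_a$ is joined by an edge to $u_1$, and similarly $P_b$ to $u_2$ and $P_c$ to $u_3$ (nothing is attached for a path with $0$ vertices). The chromatic symmetric function of a finite graph $G=(V,E)$ is $X_G=\sum_{\kappa}\prod_{v\in V}x_{\kappa(v)}$, where $\kappa\colon V\to\{1,2,\dots\}$ runs over all proper colorings of $G$. For a partition $\lambda=\lambda_1\lambda_2\cdots$, $e_\lambda=e_{\lambda_1}e_{\lambda_2}\cdots$ with $e_k=\sum_{1\le i_1<\dots<i_k}x_{i_1}\cdots x_{i_k}$. *)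

(* Defs.v *)
From HB Require Import structures.
From mathcomp Require Import all_boot all_order all_algebra.
From mathcomp Require Import finmap mpoly.

Set Implicit Arguments.
Unset Strict Implicit.
Unset Printing Implicit Defensive.

Import GRing.Theory.
Local Open Scope ring_scope.

Record sgraph := SGraph {
  vertex :> finType;
  adj : rel vertex;
  adj_sym : ssrbool.symmetric adj;
  adj_irr : irreflexive adj }.

Definition proper_coloring (G : sgraph) (N : nat) (k : {ffun G -> 'I_N}) : bool :=
  [forall v, forall w, @adj G v w ==> (k v != k w)].

(* A symmetric function in x_1, x_2, ... is represented by its truncations
   (x_i := 0 for i > N) for all N, i.e. as an element of the inverse limit of
   the rings Z[x_1, ..., x_N].  The variables of {mpoly int[N]} are numbered
   from 0. *)
Definition chromatic_symfun (G : sgraph) (N : nat) : {mpoly int[N]} :=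
  \sum_(k : {ffun G -> 'I_N} | proper_coloring k) \prod_(v : G) 'X_(k v).

Definition is_intpart (s : seq nat) : bool := sorted geq s && (0%N \notin s).

Definition intpart : Type := {s : seq nat | is_intpart s}.
HB.instance Definition _ := Choice.on intpart.

(* mesym N int k is 0 when k > N, as it must be for the truncation of e_k. *)
Definition elem_symfun (l : intpart) (N : nat) : {mpoly int[N]} :=
  \prod_(k <- val l) mesym N int k.

(* Coefficients form a finitely supported family indexed by all partitions.
   Since the identity is required for every N, c is determined by X: the e_l
   with l a partition of n are linearly independent as soon as N >= n. *)
Definition e_expansion (X : forall N, {mpoly int[N]})
    (c : {fsfun intpart -> int with 0}) : Prop :=
  forall N, X N = \sum_(l <- finsupp c) c l *: elem_symfun l N.

Definition e_positive (G : sgraph) : Prop :=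
  exists c : {fsfun intpart -> int with 0},
    e_expansion (chromatic_symfun G) c /\ forall l, 0 <= c l.

Section Trinacria.
Variables a b c : nat.

Definition arm (i : 'I_3) : nat := nth 0%N [:: a; b; c] i.

(* Tagged i 0 is the triangle vertex u_{i+1}; Tagged i j with 1 <= j <= arm i
   is the j-th vertex of the path attached to it, counted from the triangle. *)
Definition trinacria_vertex : finType := {i : 'I_3 & 'I_(arm i).+1}.

Definition trinacria_pos (x : trinacria_vertex) : nat := tagged x.

Definition trinacria_adj (x y : trinacria_vertex) : bool :=
  if tag x == tag y
  then ((trinacria_pos x).+1 == trinacria_pos y)
    || ((trinacria_pos y).+1 == trinacria_pos x)
  else (trinacria_pos x == 0%N) && (trinacria_pos y == 0%N).

Lemma trinacria_adj_sym : ssrbool.symmetric trinacria_adj.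
Proof.
by move=> x y; rewrite /trinacria_adj eq_sym orbC; case: ifP => // _; rewrite andbC.
Qed.

Lemma trinacria_adj_irr : irreflexive trinacria_adj.
Proof. by move=> x; rewrite /trinacria_adj eqxx orbb gtn_eqF. Qed.

Definition trinacria : sgraph := SGraph trinacria_adj_sym trinacria_adj_irr.

Lemma card_trinacria : #|trinacria| = (a + b + c + 3)%N.
Proof.
rewrite /= card_tagged sumnE big_map big_enum /=.
by rewrite !big_ord_recl big_ord0 !card_ord /arm /= addn0 !addSn !addnS addnA addn0.
Qed.

End Trinacria.

(* Main.v *)
Require Import Defs.
From mathcomp Require Import all_boot.
From HB Require Import structures.
From mathcomp Require Import all_order all_algebra ring zify.
From mathcomp Require Import finmap mpoly.

Set Implicit Arguments.
Unset Strict Implicit.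
Unset Printing Implicit Defensive.

Import GRing.Theory Num.Theory.

(* Write P_k for the chromatic symmetric function of the path on k vertices.
   Cutting the triangle gives X_T as a combination of products P_k P_l
   ([trinacria_paths]); doubling it, with n = 2b+7,
     2 X_T = 4 P_n + 4 e_1 P_(n-1) + 8 e_2 P_(n-2) + (6 e_3 + 2 e_1 e_2) P_(n-3)
             - sum_(t < 6) nu_t P_(b+1+t) P_(b+6-t),   nu = (1,2,3,3,2,1).
   Let f be the renewal sequence f_n = sum_(i >= 2) (i-1) e_i f_(n-i), f_0 = 1.
   Both P_n = sum_i e_i f_(n-i) and P_n = sum_i i e_i f_(n-i) hold for n > 0.
   Splitting compositions at their first partial sum b+1+r that is >= b+1 yields
   P_(b+1+t) = sum_(r <= t) A_r f_(t-r) with A_r e-positive, so that 2 X_T is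
   sum_r A_r W_r, and each W_r ([window_weight]) is e-positive: it has negative
   terms only for r < 6, where, besides f_0, ..., f_5, only expansions of f_m and
   P_m have to be compared, which yields an explicit certificate. *)

(** * Renewal sequences *)

Section Renewal.
Local Open Scope ring_scope.
Variables (R : comNzRingType) (e : nat -> R).
Implicit Types (A y : nat -> R) (n m r t w : nat).

(** With j = i + 1, the equation [y = A + renewal_step y] reads y(z) (1 - sum_j (j-1) e_j z^j) =
    A(z) in generating functions. *)
Definition renewal_step y n : R :=
  \sum_(i < n) (e i.+1 *+ i) * y (n - i.+1)%N.

(** [k] is fuel: a step only looks at smaller indices, so k >= n is enough; for n = 0 the step
    omitted at k = 0 is an empty sum. *)
Fixpoint renewal_rec k A n : R :=
  A n + if k is k'.+1 then renewal_step (renewal_rec k' A) n else 0.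

Definition renewal A n : R := renewal_rec n A n.

Lemma renewal_rec_enough k A n : (n <= k)%N -> renewal_rec k A n = renewal A n.
Proof.
suff H l m : (n <= l)%N -> (n <= m)%N -> renewal_rec l A n = renewal_rec m A n.
  by move=> nk; apply: H.
elim/ltn_ind: n l m => n IH [|l] [|m] //=; rewrite ?leqn0 => nl nm.
- by move/eqP: nl => ->; rewrite /renewal_step big_ord0.
- by move/eqP: nm => ->; rewrite /renewal_step big_ord0.
congr (_ + _); apply: eq_bigr => i _; congr (_ * _).
have n_gt0 : (0 < n)%N by apply: leq_ltn_trans (ltn_ord i).
apply: IH; first by rewrite ltn_subrL n_gt0.
- by rewrite leq_subLR (leq_trans nl) // addSn ltnS leq_addl.
- by rewrite leq_subLR (leq_trans nm) // addSn ltnS leq_addl.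
Qed.

Lemma renewalE A n : renewal A n = A n + renewal_step (renewal A) n.
Proof.
rewrite -(renewal_rec_enough A (leqnSn n)) /=; congr (_ + _).
apply: eq_bigr => i _; rewrite renewal_rec_enough //.
exact: leq_subr.
Qed.

Lemma renewal_unique A y n :
  (forall m, (m <= n)%N -> y m = A m + renewal_step y m) -> y n = renewal A n.
Proof.
elim/ltn_ind: n => n IH H; rewrite renewalE H //; congr (_ + _).
apply: eq_bigr => i _; congr (_ * _).
have lt : (n - i.+1 < n)%N by rewrite ltn_subrL (leq_ltn_trans _ (ltn_ord i)).
by apply: IH => // m mn; exact: H (leq_trans mn (ltnW lt)).
Qed.

(** Sum over the compositions of n of the product of (i-1) e_i over the parts i. *)
Definition free_renewal : nat -> R := renewal (fun n => (n == 0%N)%:R).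

(** After an exchange of the sums over r and i, the convolution is seen to solve the recursion that
    determines [renewal A]. *)
Lemma renewal_conv A n :
  renewal A n = \sum_(r < n.+1) A r * free_renewal (n - r).
Proof.
symmetry.
apply: (@renewal_unique A
  (fun m => \sum_(r < m.+1) A r * free_renewal (m - r))) => m _ {n}.
rewrite big_ord_recr /= subnn [in LHS]/free_renewal renewalE /renewal_step big_ord0.
rewrite addr0 mulr1 addrC; congr (_ + _).
transitivity (\sum_(r < m) \sum_(i < m | (i + r < m)%N)
    A r * ((e i.+1 *+ i) * free_renewal (m - r - i.+1))).
  apply: eq_bigr => r _; rewrite /free_renewal renewalE.
  rewrite subn_eq0 leqNgt ltn_ord add0r /renewal_step.
  rewrite (big_ord_widen m (fun i => e i.+1 *+ i * free_renewal (m - r - i.+1))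
    (leq_subr r m)) big_distrr /=.
  by apply: eq_bigl => i; rewrite ltn_subRL addnC.
rewrite (exchange_big_dep predT) //=; apply: eq_bigr => i _.
rewrite big_distrr /= subnSK //.
rewrite (big_ord_widen_cond m predT
  (fun r => e i.+1 *+ i * (A r * free_renewal (m - i.+1 - r))) (leq_subr i m)).
apply: eq_big => [r|r _]; first by rewrite ltn_subRL.
rewrite mulrCA -!subnDA; congr (_ * (_ * free_renewal (m - _))).
by rewrite addnC.
Qed.

(** Weight of having w + r as first partial sum >= w: either initially, or by a part i + 1 leaving
    from w + r - i - 1, which is below w exactly when r <= i. *)
Definition renewal_source A w r : R :=
  A (w + r)%N
  + \sum_(i < (w + r)%N | (r <= i)%N) (e i.+1 *+ i) * renewal A (w + r - i.+1)%N.

(** From w on the sequence is again a renewal sequence: parts leaving from w or later form its step,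
    all others go into its source. *)
Lemma renewal_shift A w t :
  renewal A (w + t)%N = \sum_(r < t.+1) renewal_source A w r * free_renewal (t - r).
Proof.
rewrite -renewal_conv.
apply: (@renewal_unique _ (fun t => renewal A (w + t)%N)) => {}t _.
rewrite renewalE -addrA; congr (_ + _).
rewrite /renewal_step (bigID (fun i : 'I__ => (t <= i)%N)) /=; congr (_ + _).
rewrite (big_ord_widen (w + t)%N
  (fun i => e i.+1 *+ i * renewal A (w + (t - i.+1))) (leq_addl w t)).
apply: eq_big => [i|i]; first by rewrite -ltnNge.
by rewrite -ltnNge => it; rewrite addnBA.
Qed.

Definition path_renewal : nat -> R := renewal e.

(** The value is 0 for i > m, where truncated subtraction would give f_0 = 1; so [free_subSS] and
    the identities below hold for all m. *)
Definition free_sub m i : R := if (i <= m)%N then free_renewal (m - i) else 0.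

Lemma free_subSS m i : free_sub m.+1 i.+1 = free_sub m i.
Proof. by rewrite /free_sub ltnS subSS. Qed.

Lemma free_sub0 m : free_sub m 0 = free_renewal m.
Proof. by rewrite /free_sub subn0. Qed.

Lemma free_subE m : (0 < m)%N ->
  free_renewal m = \sum_(i < m) e i.+1 * free_sub m i.+1 *+ i.
Proof.
move=> m_gt0; rewrite [LHS]renewalE eqn0Ngt m_gt0 add0r.
by apply: eq_bigr => i _; rewrite mulrnAl /free_sub ltn_ord.
Qed.

(** In the convolution of e and f, the term f_m = sum_i (i-1) e_i f_(m-i) raises the coefficient of
    each e_i f_(m-i), i >= 1, from 1 to i. *)
Lemma path_subE m : (0 < m)%N -> e 0%N = 1 ->
  path_renewal m = \sum_(i < m) e i.+1 * free_sub m i.+1 *+ i.+1.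
Proof.
move=> m_gt0 e0; rewrite [LHS]renewal_conv big_ord_recl e0 mul1r subn0.
rewrite free_subE // -big_split /=; apply: eq_bigr => i _.
by rewrite mulrS addrC /bump add1n /free_sub ltn_ord.
Qed.

End Renewal.

(** * Renewal sequences in a subsemiring *)

Section Positivity.
Local Open Scope ring_scope.
Variables (R : comNzRingType) (e : nat -> R) (S : semiringClosed R).
Hypotheses (e0 : e 0%N = 1) (eS : forall i, e i \in S).

Local Notation f := (free_sub e).
Local Notation P := (path_renewal e).

Lemma renewal_in A n : (forall i, A i \in S) -> renewal e A n \in S.
Proof.
move=> AS; elim/ltn_ind: n => n IH.
rewrite renewalE rpredD ?rpred_sum // => i _.
rewrite rpredM ?rpredMn ?IH // ltn_subrL (leq_ltn_trans _ (ltn_ord i)) //.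
Qed.

Lemma free_sub_in m i : f m i \in S.
Proof.
rewrite /free_sub; case: ifP => _; last exact: rpred0.
by apply: renewal_in => j; apply: rpred_nat.
Qed.

Lemma renewal_source_in w r : renewal_source e e w r \in S.
Proof.
rewrite rpredD ?rpred_sum // => i _; rewrite rpredM ?rpredMn //.
exact: renewal_in.
Qed.

(* al f_m - be P_m without the terms e_i f_(m-i), i <= K, of its expansion. *)
Definition renewal_tail (al be K m : nat) : R :=
  f m 0 *+ al + \sum_(i < K) e i.+1 * f m i.+1 *+ (be * i.+1)
  - (P m *+ be + \sum_(i < K) e i.+1 * f m i.+1 *+ (al * i)).

(** The correction sums cancel the terms i < K of al f - be P, so only terms with coefficient al i -
    be (i+1), i >= K, remain. The index is [m.+1] because the expansions of f and P require a
    positive one. *)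
Lemma renewal_tail_in (al be K m : nat) :
  (forall i, (K <= i)%N -> (be * i.+1 <= al * i)%N) -> renewal_tail al be K m.+1 \in S.
Proof.
move: (ltn0Sn m); move: m.+1 => {}m m_gt0 H; rewrite /renewal_tail.
set G := fun i => e i.+1 * f m i.+1.
(* K may exceed m, so all sums are brought to the common range N; [free_sub] vanishes beyond m. *)
pose N := maxn K m.
have widen (F : nat -> nat) (n : nat) : (n = m \/ n = K) ->
    \sum_(i < n) G i *+ F i = \sum_(i < N | (i < n)%N) G i *+ F i.
  move=> nE; apply: (big_ord_widen N (fun i => G i *+ F i)).
  by case: nE => ->; rewrite /N ?leq_maxl ?leq_maxr.
have full (F : nat -> nat) : \sum_(i < m) G i *+ F i = \sum_(i < N) G i *+ F i.
  rewrite widen; last by left.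
  rewrite big_mkcond; apply: eq_bigr => i _; case: ltnP => // mi.
  by rewrite /G /free_sub ltnNge mi mulr0 mul0rn.
rewrite free_sub0 free_subE // path_subE // -!sumrMnl.
have E c (F : nat -> nat) :
    \sum_(i < m) G i *+ F i *+ c = \sum_(i < N) G i *+ (c * F i).
  rewrite -(full (fun i => c * F i)%N); apply: eq_bigr => i _.
  by rewrite -mulrnA mulnC.
rewrite (E al id) (E be succn) (widen (fun i => be * i.+1)%N K); last by right.
rewrite (widen (fun i => al * i)%N K); last by right.
rewrite (bigID (fun i : 'I_N => (i < K)%N)) /=.
rewrite [X in _ - (X + _)](bigID (fun i : 'I_N => (i < K)%N)) /=.
set a1 := \sum_(_ < _ | _) _; set a2 := \sum_(_ < _ | _) _.
set b1 := \sum_(_ < _ | _) _ *+ (be * _); set b2 := \sum_(_ < _ | _) _.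
have -> : a1 + a2 + b1 - (b1 + b2 + a1) = a2 - b2 by ring.
rewrite -sumrB rpred_sum // => i; rewrite -leqNgt => Ki.
by rewrite -mulrnBr ?H // rpredMn // rpredM // free_sub_in.
Qed.

End Positivity.

(** * Positivity of the weights W_r *)

Section Window.
Local Open Scope ring_scope.
Variables (R : comNzRingType) (e : nat -> R) (S : semiringClosed R).
Hypotheses (e0 : e 0%N = 1) (eS : forall i, e i \in S).

Local Notation f := (free_sub e).
Local Notation P := (path_renewal e).
Local Notation T := (renewal_tail e).

(** Coefficient of A_r in 2 X_T: each split factor P_(b+1+c) contributes f_(c-r), and in the
    products the cofactor P_(b+6-t) is kept. *)
Definition window_weight b r : R :=
  f b.+4.+2 r *+ 4 + e 1 * f b.+4.+1 r *+ 4 + e 2 * f b.+4 r *+ 8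
  + (e 3 *+ 6 + e 1 * e 2 *+ 2) * f b.+3 r
  - (f 0 r * P b.+4.+2 + f 1 r * P b.+4.+1 *+ 2 + f 2 r * P b.+4 *+ 3
     + f 3 r * P b.+3 *+ 3 + f 4 r * P b.+2 *+ 2 + f 5 r * P b.+1).

Lemma free_small : [/\ f 0 0 = 1, f 1 0 = 0 & f 2 0 = e 2] /\ [/\
  f 3 0 = e 3 *+ 2, f 4 0 = e 4 *+ 3 + e 2 ^+ 2 & f 5 0 = e 5 *+ 4 + e 2 * e 3 *+ 4].
Proof.
have f0 : f 0 0 = 1.
  by rewrite free_sub0 /free_renewal renewalE /renewal_step big_ord0 addr0.
have fS m : f m.+1 0 = \sum_(i < m.+1) e i.+1 * f m i *+ i.
  by rewrite free_sub0 free_subE //; apply: eq_bigr => i _; rewrite free_subSS.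
have f1 : f 1 0 = 0 by rewrite fS big_ord1 mulr0n.
have f2 : f 2 0 = e 2.
  by rewrite fS !big_ord_recl big_ord0 !free_subSS f0 /= /bump /=; ring.
have f3 : f 3 0 = e 3 *+ 2.
  by rewrite fS !big_ord_recl big_ord0 !free_subSS f0 f1 /= /bump /=; ring.
have f4 : f 4 0 = e 4 *+ 3 + e 2 ^+ 2.
  by rewrite fS !big_ord_recl big_ord0 !free_subSS f0 f1 f2 /= /bump /=; ring.
do 2!split=> //.
by rewrite fS !big_ord_recl big_ord0 !free_subSS f0 f1 f2 f3 /= /bump /=; ring.
Qed.

Ltac in_cone :=
  repeat match goal with
  | |- is_true (renewal_tail _ _ _ _ _ \in _) => apply: renewal_tail_in => //; lia
  | |- is_true (free_sub _ _ _ \in _) => exact: free_sub_in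
  | |- is_true (_ + _ \in _) => apply: rpredD
  | |- is_true (_ *+ _ \in _) => apply: rpredMn
  | |- is_true (_ * _ \in _) => apply: rpredM
  | |- is_true (_ ^+ _ \in _) => apply: rpredX
  | |- _ => exact: eS
  end.

Ltac expand_tail :=
  rewrite /renewal_tail !big_ord_recl !big_ord0 /= /bump /= !free_subSS; ring.

(** For r <= 5 each negative multiple of some P_m is absorbed by a tail [T al be K m] with be > 0.
    Tails with be = 0 are surplus f_m without their first K terms, which compensate what other tails
    subtract; the last bracket is the remainder. The side condition be (i+1) <= al i for i >= K is
    left to [lia], the identity to [ring]. *)
Lemma window_weight_in b r : window_weight b r \in S.
Proof.
have [[f0 f1 f2] [f3 f4 f5]] := free_small.
have f0S i : f 0 i.+1 = 0 by [].
case: r => [|[|[|[|[|[|r]]]]]]; rewrite /window_weight ?f0S ?free_subSS ?f0S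
  ?f0 ?f1 ?f2 ?f3 ?f4 ?f5.
- rewrite (_ : _ - _ = T 4 1 5 b.+4.+2 + e 2 * T 2 1 3 b.+4 *+ 3 + e 3 * T 11 6 4 b.+3
      + e 4 * T 4 3 3 b.+2 *+ 2 + e 5 * T 11 4 1 b.+1
      + e 2 * T 1 0 4 b.+4 *+ 4 + e 2 ^+ 2 * T 2 1 1 b.+2 *+ 2
      + e 2 * e 3 * T 2 1 1 b.+1 *+ 4
      + e 1 * (T 1 0 5 b.+4.+1 *+ 3 + e 2 * T 1 0 3 b.+3 *+ 2)
      + (e 2 * e 3 * f b.+1 0 *+ 2 + e 3 ^+ 2 * f b 0 *+ 4
         + e 3 * e 4 * f b 1 *+ 7 + e 2 * e 4 * f b 0 *+ 8
         + e 1 * e 4 * f b.+1 0 *+ 3 + e 1 * e 5 * f b 0 *+ 8)).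
    by in_cone.
  by expand_tail.
- rewrite (_ : _ - _ = T 4 2 4 b.+4.+1 + e 2 * T 2 1 1 b.+3 *+ 3
      + e 3 * T 2 1 4 b.+2 *+ 4 + e 4 * T 4 3 3 b.+1 + e 2 ^+ 2 * T 2 1 1 b.+1
      + e 2 * T 1 0 4 b.+3 *+ 2
      + e 1 * (T 1 0 4 b.+4 *+ 2 + e 2 * T 1 0 2 b.+2)
      + (e 3 ^+ 2 * f b 1 *+ 4 + e 3 * e 4 * f b 2 *+ 7
         + e 1 * e 4 * f b 0 *+ 3 + e 2 * e 4 * f b 1 *+ 4
         + e 2 * e 3 * f b 0 *+ 4)).
    by in_cone.
  by expand_tail.
- rewrite (_ : _ - _ = T 4 3 3 b.+4 + e 2 * T 2 1 1 b.+2 *+ 2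
      + e 3 * T 2 1 1 b.+1 *+ 2 + e 1 * T 1 0 3 b.+3
      + (e 2 * f b.+2 0 *+ 2 + e 3 * f b.+1 0 + e 1 * e 2 * f b.+1 0)).
    by in_cone.
  by expand_tail.
- rewrite (_ : _ - _ = T 4 3 3 b.+3 + e 2 * T 2 1 1 b.+1
      + (e 1 * f b.+2 0 + e 2 * f b.+1 0 *+ 4 + e 3 * f b 0 *+ 5
         + e 1 * e 2 * f b 0)).
    by in_cone.
  by expand_tail.
- rewrite (_ : _ - _ = T 4 2 1 b.+2
      + (e 1 * f b.+1 0 *+ 2 + e 2 * f b 0 *+ 8 + e 3 * f b 1 *+ 6
         + e 1 * e 2 * f b 1 *+ 2)).
    by in_cone.
  by expand_tail.
- rewrite (_ : _ - _ = T 4 1 1 b.+1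
      + (e 1 * f b 0 *+ 3 + e 2 * f b 1 *+ 8 + e 3 * f b 2 *+ 6
         + e 1 * e 2 * f b 2 *+ 2)).
    by in_cone.
  by expand_tail.
(* For r >= 6 all f_(t-r) with t <= 5 vanish, so no negative term is left. *)
- rewrite !mul0r !mul0rn !addr0 subr0.
  by in_cone.
Qed.

(** The expression of X_T in path functions. Sizes are written as b + 1 + c so that [renewal_shift]
    applies at w = b + 1. *)
Definition trinacria_paths b : R :=
  P (b.+1 + b.+4.+2) *+ 2 + P 1 * P (b.+1 + b.+4.+1) *+ 2
  + P 2 * P (b.+1 + b.+4) *+ 2 + P 3 * P (b.+1 + b.+3)
  - (P b.+1 * P b.+4.+2 + P b.+2 * P b.+4.+1 *+ 2 + P b.+3 * P b.+4 *+ 3).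

Lemma path_small : [/\ P 1 = e 1, P 2 = e 2 *+ 2 & P 3 = e 3 *+ 3 + e 1 * e 2].
Proof.
have [[f0 f1 f2] [f3 f4 f5]] := free_small.
by split; rewrite path_subE // !big_ord_recl big_ord0 !free_subSS ?f0 ?f1 ?f2 /=;
  rewrite /bump /=; ring.
Qed.

(** After doubling, each product P_(b+1+t) P_(b+6-t) is shared evenly between t and 5 - t, so either
    factor is split once; this turns the coefficients 1, 2, 3 into nu. *)
Lemma trinacria_paths_in b : trinacria_paths b *+ 2 \in S.
Proof.
suff -> : trinacria_paths b *+ 2
    = \sum_(r < b.+4.+3) renewal_source e e b.+1 r * window_weight b r.
  rewrite rpred_sum // => r _.
  by rewrite rpredM ?window_weight_in // renewal_source_in.
(* All splittings get the same range of r, since f_(c-r) = 0 for r > c. *)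
have shift c : (c < b.+4.+3)%N -> P (b.+1 + c)%N
    = \sum_(r < b.+4.+3) renewal_source e e b.+1 r * f c r.
  move=> cb; rewrite [LHS]renewal_shift.
  rewrite (big_ord_widen b.+4.+3
    (fun r => renewal_source e e b.+1 r * free_renewal e (c - r)) cb).
  rewrite big_mkcond; apply: eq_bigr => r _.
  by rewrite /free_sub ltnS; case: leqP => // _; rewrite mulr0.
set F := fun c => \sum_(r < b.+4.+3) renewal_source e e b.+1 r * f c r.
have -> : \sum_(r < b.+4.+3) renewal_source e e b.+1 r * window_weight b r
    = F b.+4.+2 *+ 4 + e 1 * F b.+4.+1 *+ 4 + e 2 * F b.+4 *+ 8
      + (e 3 *+ 6 + e 1 * e 2 *+ 2) * F b.+3
      - (F 0%N * P b.+4.+2 + F 1%N * P b.+4.+1 *+ 2 + F 2%N * P b.+4 *+ 3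
         + F 3%N * P b.+3 *+ 3 + F 4%N * P b.+2 *+ 2 + F 5%N * P b.+1).
  rewrite /F !(mulr_sumr, mulr_suml, =^~ sumrMnl) -!big_split -sumrB.
  by apply: eq_bigr => r _; rewrite /window_weight /=; ring.
rewrite /F -!shift; try lia.
have [p1 p2 p3] := path_small.
rewrite /trinacria_paths p1 p2 p3 !addnS !addn0 !addSn; ring.
Qed.

End Window.

(** * Path colorings by first color *)

Section PathColorings.
Local Open Scope ring_scope.
Variables (R : comNzRingType) (C : finType) (x : C -> R).

(* Junk at [k = 0]: [path_head 0 c = 0], although [path_total 0 = 1]. *)
Fixpoint path_head k (c : C) : R :=
  if k is k'.+1 then
    x c * ((if k' is 0 then 1 else \sum_(d : C) path_head k' d) - path_head k' c)
  else 0.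

Definition path_total k : R :=
  if k is 0 then 1 else \sum_(c : C) path_head k c.

Arguments path_head : simpl never.
Arguments path_total : simpl never.

(** The vertex after the first must avoid c. At k = 0 the junk value 0 makes the formula give
    x_c. *)
Lemma path_headS k c : path_head k.+1 c = x c * (path_total k - path_head k c).
Proof. by case: k. Qed.

Lemma path_totalS k : path_total k.+1 = \sum_c path_head k.+1 c.
Proof. by []. Qed.

(** Written like [mesym], so that the two are convertible when the colors are 'I_N. *)
Definition elem_sym j : R := \sum_(A : {set C} | #|A| == j) \prod_(c in A) x c.

Let with_color (c : C) j : R :=
  \sum_(A : {set C} | (#|A| == j) && (c \in A)) \prod_(d in A) x d.
Let without_color (c : C) j : R :=
  \sum_(A : {set C} | (#|A| == j) && (c \notin A)) \prod_(d in A) x d.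

Lemma elem_sym_split c j : elem_sym j = with_color c j + without_color c j.
Proof. by rewrite /elem_sym (bigID (fun A : {set C} => c \in A)). Qed.

Lemma with_colorS c j : with_color c j.+1 = x c * without_color c j.
Proof.
rewrite /with_color (reindex_onto (fun A => c |: A) (fun A => A :\ c)) /=; last first.
  by move=> A /andP[_ cA]; rewrite setD1K.
rewrite big_distrr /=; apply: eq_big => [A|A].
  rewrite setU11 andbT; case: (boolP (c \in A)) => cA /=.
    rewrite andbF andbC; apply/negbTE; rewrite negb_and; apply/orP; left.
    by apply/eqP => E; move: cA; rewrite -E !inE eqxx.
  by rewrite cardsU1 cA eqSS setU1K // eqxx !andbT.
case/andP=> _ /eqP E; rewrite big_setU1 //.
by rewrite -E !inE eqxx.
Qed.

Lemma with_color0 c : with_color c 0 = 0.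
Proof.
by apply: big1 => A /andP[/eqP/cards0_eq -> ]; rewrite inE.
Qed.

(** Each set of size j is counted once for each of its elements. *)
Lemma sum_with_color j : \sum_c with_color c j = elem_sym j *+ j.
Proof.
rewrite /with_color (exchange_big_dep (fun A : {set C} => #|A| == j)) /=; last first.
  by move=> c A _ /andP[].
rewrite /elem_sym -sumrMnl; apply: eq_bigr => A /eqP Aj.
by rewrite Aj eqxx /= sumr_const Aj.
Qed.

(* Coefficientwise form of p_c(z) E(z) = x_c z E_c(z) P(z), where p_c counts the
   colorings starting with c and E_c omits the variable x_c. *)
Lemma elem_sym_path_head c n :
  \sum_(j < n.+1) elem_sym j * path_head (n - j) c
  = \sum_(j < n.+1) with_color c j * path_total (n - j).
Proof.
elim: n => [|n IH]; first by rewrite !big_ord1 subnn with_color0 mul0r mulr0.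
rewrite big_ord_recr /= subnn mulr0 addr0.
rewrite [RHS]big_ord_recl with_color0 mul0r add0r.
transitivity (x c * (\sum_(j < n.+1) elem_sym j * path_total (n - j)
                     - \sum_(j < n.+1) elem_sym j * path_head (n - j) c)).
  rewrite -sumrB mulr_sumr; apply: eq_bigr => j _.
  by rewrite subSn ?leq_ord // path_headS; ring.
rewrite IH -sumrB mulr_sumr; apply: eq_bigr => j _.
by rewrite lift0 subSS with_colorS (elem_sym_split c); ring.
Qed.

(** Summing [elem_sym_path_head] over c gives E(z) (P(z) - 1) = z E'(z) P(z), that is P (E - z E') =
    E, and E - z E' = 1 - sum_j (j-1) e_j z^j. *)
Lemma path_total_renewal n :
  path_total n
  = elem_sym n + \sum_(i < n) (elem_sym i.+1 *+ i) * path_total (n - i.+1)%N.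
Proof.
have e0 : elem_sym 0 = 1.
  rewrite /elem_sym (big_pred1 set0) ?big_set0 // => A.
  by rewrite cards_eq0.
(* The correction at k = 0 comes from the junk value of [path_head]. *)
have total k : \sum_c path_head k c = path_total k - (k == 0%N)%:R.
  by case: k => [|k]; rewrite ?subr0 // big1 ?subrr.
have : \sum_(j < n.+1) elem_sym j * (path_total (n - j) - (n - j == 0)%N%:R)
    = \sum_(j < n.+1) (elem_sym j *+ j) * path_total (n - j).
  under eq_bigr => j _ do rewrite -total mulr_sumr.
  under [RHS]eq_bigr => j _ do rewrite -sum_with_color mulr_suml.
  rewrite exchange_big [RHS]exchange_big /=.
  by apply: eq_bigr => c _; apply: elem_sym_path_head.
under eq_bigr => j _ do rewrite mulrBr.
rewrite sumrB big_ord_recl e0 mul1r subn0.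
rewrite [X in _ - X]big_ord_recr /= subnn mulr1.
rewrite [X in _ - (X + _)]big1 => [|j _]; last first.
  by rewrite subn_eq0 leqNgt ltn_ord mulr0.
rewrite [in RHS]big_ord_recl mul0r !add0r => H.
have {H}/eqP : path_total n + \sum_(i < n) elem_sym i.+1 * path_total (n - i.+1)
      - elem_sym n
    = \sum_(i < n) (elem_sym i.+1 *+ i.+1) * path_total (n - i.+1) := H.
rewrite subr_eq => /eqP E.
apply: (addIr (\sum_(i < n) elem_sym i.+1 * path_total (n - i.+1))).
rewrite E -addrA -big_split addrC; congr (_ + _); apply: eq_bigr => i _ /=.
by rewrite mulrS; ring.
Qed.

(** * Several paths with a common first color *)

Definition head2 k l := \sum_c path_head k c * path_head l c.
Definition head3 k l m := \sum_c path_head k c * path_head l c * path_head m c.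

Lemma path_head1 c : path_head 1 c = x c.
Proof. by rewrite path_headS subr0 mulr1. Qed.

Lemma head2_1 k : (0 < k)%N ->
  head2 k 1 = path_total k * path_total 1 - path_total k.+1.
Proof.
case: k => // k _; rewrite /head2 !path_totalS mulr_sumr -sumrB.
apply: eq_bigr => c _.
by rewrite -path_totalS path_head1 (path_headS k.+1); ring.
Qed.

(** Two path colorings with different first colors form a coloring of the path on k + l vertices,
    obtained by joining the first vertices. *)
Lemma head2E k l : (0 < k)%N -> (0 < l)%N ->
  head2 k l = path_total k * path_total l - path_total (k + l).
Proof.
case: l => // l k_gt0 _; elim: l k k_gt0 => [|l IH] k k_gt0.
  by rewrite addn1 head2_1.
(* Peeling off the first vertex of the longer path on either side leaves the same sum of x_c times
   both heads; this moves one vertex between the paths. *)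
have -> : head2 k l.+2 = head2 k.+1 l.+1
    + (path_total l.+1 * head2 k 1 - path_total k * head2 l.+1 1).
  rewrite /head2 !mulr_sumr -sumrB -big_split; apply: eq_bigr => c _ /=.
  by rewrite !path_head1 (path_headS l.+1) (path_headS k); ring.
by rewrite IH // !head2_1 // addSnnS; ring.
Qed.

Lemma head3_1 k l : (0 < k)%N -> (0 < l)%N ->
  head3 k l 1 = path_total k * head2 1 l - head2 k.+1 l.
Proof.
move=> k_gt0 l_gt0; rewrite /head3 /head2 mulr_sumr -sumrB.
by apply: eq_bigr => c _; rewrite path_head1 (path_headS k); ring.
Qed.

(** The same transfer of a vertex; applied twice, it reduces a third path on 3 vertices to one
    vertex, where [head3_1] takes over. *)
Lemma head3S k l m :
  head3 k l m.+1 = path_total m * head3 k l 1 - path_total k * head3 l m 1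
                   + head3 k.+1 l m.
Proof.
rewrite /head3 !mulr_sumr -sumrB -big_split; apply: eq_bigr => c _ /=.
by rewrite !path_head1 (path_headS k) (path_headS m); ring.
Qed.

(** Inclusion-exclusion over the partitions of three indices; the coefficient 2 is the Moebius value
    of the one-block partition. *)
Lemma sum_pairwise_distinct (p q r : C -> R) :
  \sum_a \sum_(b | a != b) \sum_(c | (a != c) && (b != c)) p a * q b * r c
  = (\sum_a p a) * (\sum_a q a) * (\sum_a r a)
    - (\sum_a p a * q a) * (\sum_a r a) - (\sum_a p a * r a) * (\sum_a q a)
    - (\sum_a q a * r a) * (\sum_a p a) + (\sum_a p a * q a * r a) *+ 2.
Proof.
have inner a b : a != b -> \sum_(c | (a != c) && (b != c)) p a * q b * r c
    = p a * q b * (\sum_c r c - r a - r b).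
  move=> ab; rewrite mulrBr mulrBr mulr_sumr.
  rewrite [in RHS](bigD1 a) //= [in RHS](bigD1 b) ?(eq_sym b) //=.
  rewrite (eq_bigl (fun c => (c != a) && (c != b))); first by ring.
  by move=> c; rewrite (eq_sym a) (eq_sym b).
have mid a : \sum_(b | a != b) \sum_(c | (a != c) && (b != c)) p a * q b * r c
    = p a * (\sum_b q b) * (\sum_c r c) - p a * r a * (\sum_b q b)
      - p a * (\sum_b q b * r b) - p a * q a * (\sum_c r c)
      + p a * q a * r a *+ 2.
  under eq_bigr => b ab do rewrite inner //.
  have -> : \sum_(b | a != b) p a * q b * (\sum_c r c - r a - r b)
      = \sum_b p a * q b * (\sum_c r c - r a - r b)
        - p a * q a * (\sum_c r c - r a - r a).
    rewrite [in RHS](bigD1 a) //= addrC addrK.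
    by apply: eq_bigl => b; rewrite eq_sym.
  have -> : \sum_b p a * q b * (\sum_c r c - r a - r b)
      = p a * (\sum_c r c - r a) * (\sum_b q b) - p a * (\sum_b q b * r b).
    rewrite !mulr_sumr -sumrB; apply: eq_bigr => b _.
    by move: (\sum_c r c) => z; ring.
  by move: (\sum_c r c) (\sum_b q b) (\sum_b q b * r b) => z1 z2 z3; ring.
rewrite (eq_bigr _ (fun a _ => mid a)) big_split !sumrB sumrMnl /= -!mulr_suml.
by ring.
Qed.

End PathColorings.

Arguments path_head : simpl never.
Arguments path_total : simpl never.

(** * Colorings of the trinacria *)

Section TrinacriaColorings.
Local Open Scope ring_scope.
Variables (R : comNzRingType) (C : finType) (x : C -> R).

Local Notation neq := (fun c d : C => c != d).

(** Ties the recursion to actual colorings, listed along the path; removing the first entry of a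
    tuple matches [path_headS]. *)
Lemma path_head_tuple k c :
  path_head x k.+1 c
  = \sum_(t : k.+1.-tuple C | (thead t == c) && sorted neq t) \prod_(d <- t) x d.
Proof.
have cons_bij m : bijective (fun p : C * m.-tuple C => [tuple of p.1 :: p.2]).
  exists (fun t : m.+1.-tuple C => (thead t, [tuple of behead t])).
    by case=> d t /=; congr pair; apply: val_inj.
  by move=> t; rewrite -tuple_eta.
elim: k c => [|k IH] c; rewrite (reindex _ (onW_bij _ (cons_bij _))) /=;
  rewrite -(pair_big_dep (fun d => d == c) (fun d t => path neq d (val t))
    (fun d t => \prod_(d' <- d :: val t) x d')) /= big_pred1_eq.
  rewrite (big_pred1 [tuple]) => [|t]; last by rewrite tuple0 /= eqxx.
  by rewrite /= big_cons big_nil mulr1 path_head1.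
rewrite path_headS path_totalS.
have -> : \sum_d path_head x k.+1 d - path_head x k.+1 c
    = \sum_(d | c != d) path_head x k.+1 d.
  rewrite (bigD1 c) //= addrC addrK; apply: eq_bigl => d.
  by rewrite eq_sym.
under [in LHS]eq_bigr => d _ do rewrite IH.
rewrite (exchange_big_dep predT) //= mulr_sumr.
rewrite [RHS]big_mkcond; apply: eq_bigr => t _.
rewrite big_cons; case: t => -[|d s] //= ds; rewrite [thead _]/thead (tnth_nth c) /=.
case: (boolP (c != d)) => cd /=.
  case: (boolP (path neq d s)) => ps.
    rewrite (big_pred1 d) // => d'; rewrite andbT.
    by rewrite /= (eq_sym d'); case: (eqVneq d d') => [<-|_]; rewrite ?cd ?andbF.
  by rewrite big1 ?mulr0 // => d'; rewrite !andbF.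
rewrite big1 ?mulr0 // => d' /andP[cd' /andP[/eqP E _]].
by move: cd; rewrite E cd'.
Qed.

Variables a b c : nat.
Local Notation V := (trinacria_vertex a b c).
Local Notation i0 := (@Ordinal 3 0 isT).
Local Notation i1 := (@Ordinal 3 1 isT).
Local Notation i2 := (@Ordinal 3 2 isT).
Local Notation arms := (a.+1.-tuple C * b.+1.-tuple C * c.+1.-tuple C)%type.

Local Notation vtx i j :=
  (Tagged (fun u : 'I_3 => 'I_(arm a b c u).+1) (j : 'I_(arm a b c i).+1)).

Definition arm_index (v : V) : 'I_3 := tag v.

Definition arm_colors (t : arms) (i : nat) : seq C :=
  nth [::] [:: val t.1.1; val t.1.2; val t.2] i.

(** The default color is never returned, as positions stay within the arm; it is taken from [t]
    because C may be empty. *)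
Definition glue_arms (t : arms) : {ffun V -> C} :=
  [ffun v => nth (thead t.1.1) (arm_colors t (arm_index v)) (trinacria_pos v)].

Definition split_arms (k : {ffun V -> C}) : arms :=
  ([tuple k (vtx i0 j) | j < a.+1], [tuple k (vtx i1 j) | j < b.+1],
   [tuple k (vtx i2 j) | j < c.+1]).

Lemma ord3P (P : 'I_3 -> Prop) : P i0 -> P i1 -> P i2 -> forall i, P i.
Proof.
move=> P0 P1 P2 [[|[|[|i]]] lt] //.
- by rewrite (_ : Ordinal lt = i0) //; apply: val_inj.
- by rewrite (_ : Ordinal lt = i1) //; apply: val_inj.
- by rewrite (_ : Ordinal lt = i2) //; apply: val_inj.
Qed.

Lemma glue_armsK : cancel glue_arms split_arms.
Proof.
case=> [[t0 t1] t2]; rewrite /split_arms.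
by congr (_, _, _); apply: eq_from_tnth => j;
  rewrite tnth_mktuple ffunE /trinacria_pos /= -tnth_nth.
Qed.

Lemma split_armsK : cancel split_arms glue_arms.
Proof.
move=> k; apply/ffunP => -[i j]; rewrite ffunE /trinacria_pos /=.
by move: i j; apply: ord3P => j; rewrite /arm_colors nth_mktuple.
Qed.

Lemma size_arm_colors t (i : 'I_3) : size (arm_colors t i) = (arm a b c i).+1.
Proof. by move: i; apply: ord3P; rewrite /arm_colors /= size_tuple. Qed.

Definition proper_arms (t : arms) : bool :=
  [&& sorted neq t.1.1, sorted neq t.1.2 & sorted neq t.2] &&
  [&& thead t.1.1 != thead t.1.2, thead t.1.1 != thead t.2 & thead t.1.2 != thead t.2].

Lemma proper_glue_arms t :
  [forall v : V, forall w : V,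
     trinacria_adj v w ==> (glue_arms t v != glue_arms t w)] = proper_arms t.
Proof.
apply/idP/idP.
  move/forallP=> H.
  have ne i j i' j' :
      trinacria_adj (vtx i j)
        (vtx i' j') ->
      nth (thead t.1.1) (arm_colors t i) j != nth (thead t.1.1) (arm_colors t i') j'.
    move=> adj; move: (H (vtx i j)) => /forallP/(_ (vtx i' j'))/implyP/(_ adj).
    by rewrite !ffunE.
  have srt (i : 'I_3) : sorted neq (arm_colors t i).
    apply/(sortedP (thead t.1.1)) => j; rewrite size_arm_colors => ji.
    apply: (ne i (Ordinal (ltnW ji)) i (Ordinal ji)).
    by rewrite /trinacria_adj /trinacria_pos /= !eqxx.
  have hd (i i' : 'I_3) : i != i' ->
      nth (thead t.1.1) (arm_colors t i) 0 != nth (thead t.1.1) (arm_colors t i') 0.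
    move=> ii'; apply: (ne i ord0 i' ord0).
    by rewrite /trinacria_adj /= (negbTE ii').
  apply/andP; split; apply/and3P; split;
    [exact: (srt i0)|exact: (srt i1)|exact: (srt i2)| | |];
    rewrite /thead !(tnth_nth (thead t.1.1)).
  - exact: (hd i0 i1).
  - exact: (hd i0 i2).
  - exact: (hd i1 i2).
case/andP=> /and3P[s0 s1 s2] /and3P[h01 h02 h12].
have srt (i : 'I_3) : sorted neq (arm_colors t i) by move: i; apply: ord3P.
have hd (i i' : 'I_3) : i != i' ->
    nth (thead t.1.1) (arm_colors t i) 0 != nth (thead t.1.1) (arm_colors t i') 0.
  have h (k : nat) (s : k.+1.-tuple C) d : nth d s 0 = thead s.
    by rewrite /thead (tnth_nth d).
  move: i i'; apply: ord3P; apply: ord3P => //= _;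
    by rewrite /arm_colors /= ?h // eq_sym.
apply/forallP => -[i j]; apply/forallP => -[i' j']; apply/implyP.
rewrite /trinacria_adj /trinacria_pos !ffunE /trinacria_pos /=.
case: eqVneq => [E|ii'] adj; last first.
  by case/andP: adj => /eqP -> /eqP ->; apply: hd.
have S (k : nat) : (k < arm a b c i)%N ->
    nth (thead t.1.1) (arm_colors t i) k != nth (thead t.1.1) (arm_colors t i) k.+1.
  move=> ki; have /(sortedP (thead t.1.1)) H := srt i.
  by apply: H; rewrite size_arm_colors.
move: (ltn_ord j) (ltn_ord j') adj; move: (nat_of_ord j) (nat_of_ord j') => m m'.
rewrite -E => mi m'i /orP[/eqP mm'|/eqP mm']; move: mi m'i; rewrite -mm' ltnS => mi m'i.
  exact: S.
by rewrite eq_sym; apply: S.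
Qed.

(** A proper coloring is a triple of path colorings whose first colors differ pairwise; the sum is
    grouped by the colors p, q, r of the triangle. *)
Lemma trinacria_coloring_sum :
  \sum_(k : {ffun V -> C} | [forall v : V, forall w : V,
     trinacria_adj v w ==> (k v != k w)]) \prod_(v : V) x (k v)
  = \sum_p \sum_(q | p != q) \sum_(r | (p != r) && (q != r))
      path_head x a.+1 p * path_head x b.+1 q * path_head x c.+1 r.
Proof.
pose w m (t : m.-tuple C) := \prod_(d <- t) x d.
have prodE t : \prod_(v : V) x (glue_arms t v) = w _ t.1.1 * w _ t.1.2 * w _ t.2.
  pose G (i : 'I_3) (j : 'I_(arm a b c i).+1) :=
    x (nth (thead t.1.1) (arm_colors t i) j).
  transitivity (\prod_(i : 'I_3) \prod_(j : 'I_(arm a b c i).+1) G i j).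
    rewrite (sig_big_dep predT (fun i => predT) G) /=.
    by apply: eq_bigr => v _; rewrite ffunE.
  rewrite [LHS]big_ord_recl [X in _ * X]big_ord_recl [X in _ * (_ * X)]big_ord_recl.
  rewrite [X in _ * (_ * (_ * X))]big_ord0 mulr1 mulrA /w !big_tuple.
  by congr (_ * _ * _); apply: eq_bigr => j _; rewrite /G (tnth_nth (thead t.1.1)).
rewrite (reindex glue_arms); last first.
  by exists split_arms => t _; rewrite ?glue_armsK ?split_armsK.
rewrite (eq_bigl _ _ proper_glue_arms) (eq_bigr _ (fun t _ => prodE t)).
rewrite [RHS]pair_big_dep [RHS]pair_big_dep /=.
rewrite (partition_big (fun t : arms => (thead t.1.1, thead t.1.2, thead t.2))
  (fun u => (u.1.1 != u.1.2) && ((u.1.1 != u.2) && (u.1.2 != u.2)))) /=; last first.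
  by move=> t /andP[_ /and3P[-> -> ->]].
apply: eq_bigr => -[[p q] r] /= /and3P[pq pr qr].
rewrite !path_head_tuple big_distrlr pair_big big_distrlr pair_big /=.
apply: eq_bigl => -[[t0 t1] t2] /=; rewrite /proper_arms /= !xpair_eqE.
apply/idP/idP.
  by case/andP=> /andP[/and3P[-> -> ->] _] /andP[/andP[-> ->] ->].
case/andP=> /andP[/andP[/eqP -> ->] /andP[/eqP -> ->]] /andP[/eqP -> ->].
by rewrite pq pr qr !eqxx.
Qed.

End TrinacriaColorings.

(** * Expansion in the elementary basis *)

Section FormalExpansion.
Local Open Scope ring_scope.

(** Only e_0, ..., e_n enter P_n. The bound i <= n matters since [formal_elem] is truncated. *)
Lemma path_renewal_morph (R R' : comNzRingType) (phi : {rmorphism R -> R'})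
    (e : nat -> R) (e' : nat -> R') n :
  (forall i, (i <= n)%N -> phi (e i) = e' i) ->
  phi (path_renewal e n) = path_renewal e' n.
Proof.
elim/ltn_ind: n => n IH H.
rewrite /path_renewal !renewalE rmorphD H // rmorph_sum; congr (_ + _).
apply: eq_bigr => i _; rewrite rmorphM rmorphMn H //; congr (_ * _).
have lt : (n - i.+1 < n)%N by rewrite ltn_subrL (leq_ltn_trans _ (ltn_ord i)).
by apply: IH => // j ji; apply: H; exact: leq_trans ji (ltnW lt).
Qed.

Lemma trinacria_paths_morph (R R' : comNzRingType) (phi : {rmorphism R -> R'})
    (e : nat -> R) (e' : nat -> R') b :
  (forall i, (i <= b.+1 + b.+4.+2)%N -> phi (e i) = e' i) ->
  phi (trinacria_paths e b) = trinacria_paths e' b.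
Proof.
move=> H; have E n : (n <= b.+1 + b.+4.+2)%N ->
    phi (path_renewal e n) = path_renewal e' n.
  by move=> nb; apply: path_renewal_morph => i ni; apply: H; apply: leq_trans nb.
rewrite /trinacria_paths; move: (path_renewal e) E => P E.
by rewrite !(rmorphMn, rmorphB, rmorphD, rmorphM) /= !E //; lia.
Qed.

Lemma path_total_renewalE (R : comNzRingType) (C : finType) (x : C -> R) n :
  path_total x n = path_renewal (elem_sym x) n.
Proof. by apply: renewal_unique => m _; exact: path_total_renewal. Qed.

Lemma trinacria_head_sum (R : comNzRingType) (C : finType) (x : C -> R) b :
  \sum_p \sum_(q | p != q) \sum_(r | (p != r) && (q != r))
      path_head x b.+3 p * path_head x b.+1 q * path_head x 3 r
  = trinacria_paths (elem_sym x) b.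
Proof.
rewrite sum_pairwise_distinct -!path_totalS.
rewrite -[\sum_a (_ * _ * _)]/(head3 x b.+3 b.+1 3).
rewrite -[\sum_a path_head x b.+3 a * path_head x b.+1 a]/(head2 x b.+3 b.+1).
rewrite -[\sum_a path_head x b.+3 a * path_head x 3 a]/(head2 x b.+3 3).
rewrite -[\sum_a path_head x b.+1 a * path_head x 3 a]/(head2 x b.+1 3).
rewrite (head3S _ _ _ 2) (head3S _ _ _ 1) !head3_1 // !head2E //.
rewrite /trinacria_paths -!path_total_renewalE !addnS !addSn ?addn0 ?add0n; ring.
Qed.

Lemma chromatic_trinacria b N :
  chromatic_symfun (trinacria (b + 2) b 2) N = trinacria_paths (mesym N int) b.
Proof.
rewrite addn2 -[mesym N int]/(elem_sym (fun i : 'I_N => 'X_i : {mpoly int[N]})).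
by rewrite -trinacria_head_sum -trinacria_coloring_sum.
Qed.

(** * Polynomials in formal elementary functions *)

(** Independent variables stand for e_1, ..., e_n, with e_i at variable i - 1, e_0 = 1, and 0 beyond
    n. Coefficients computed here serve all N at once. *)
Definition formal_elem n (i : nat) : {mpoly int[n]} :=
  if i is j.+1 then oapp (fun k : 'I_n => 'X_k) 0 (insub j) else 1.

Definition elem_tuple n N : n.-tuple {mpoly int[N]} :=
  [tuple mesym N int i.+1 | i < n].

Lemma formal_elemE n N i : (i <= n)%N ->
  formal_elem n i \mPo elem_tuple n N = mesym N int i.
Proof.
case: i => [_|j jn] /=; first by rewrite comp_mpoly1 mesym0E.
by rewrite insubT /= comp_mpolyXU -tnth_nth tnth_mktuple.
Qed.

(** The subsemiring taken as [S] in the positivity argument. *)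
Definition coef_nneg n : pred {mpoly int[n]} :=
  fun p => all (fun m => 0 <= p@_m) (msupp p).

Lemma coef_nnegP n (p : {mpoly int[n]}) :
  reflect (forall m, 0 <= p@_m) (p \in @coef_nneg n).
Proof.
apply: (iffP allP) => [H m|H m _]; last exact: H.
by case: (boolP (m \in msupp p)) => [/H|/memN_msupp_eq0 ->].
Qed.

Lemma coef_nneg_add_closed n : addr_closed (@coef_nneg n).
Proof.
split=> [|p q /coef_nnegP p0 /coef_nnegP q0]; apply/coef_nnegP => m.
  by rewrite mcoeff0.
by rewrite mcoeffD addr_ge0.
Qed.

HB.instance Definition _ n :=
  GRing.isAddClosed.Build {mpoly int[n]} (@coef_nneg n) (@coef_nneg_add_closed n).

Lemma coef_nneg_mul_closed n : mulr_closed (@coef_nneg n).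
Proof.
split=> [|p q /coef_nnegP p0 /coef_nnegP q0]; apply/coef_nnegP => m.
  by rewrite mcoeff1; case: eqP.
by rewrite mcoeffM; apply: sumr_ge0 => k _; apply: mulr_ge0.
Qed.

HB.instance Definition _ n :=
  GRing.isMulClosed.Build {mpoly int[n]} (@coef_nneg n) (@coef_nneg_mul_closed n).

Lemma formal_trinacria_ge0 b n m : 0 <= (trinacria_paths (formal_elem n) b)@_m.
Proof.
have : trinacria_paths (formal_elem n) b *+ 2 \in @coef_nneg n.
  apply: trinacria_paths_in => // -[|j] /=; first exact: rpred1.
  case: insub => [k|] /=; last exact: rpred0.
  by apply/coef_nnegP => m'; rewrite mcoeffX; case: eqP.
(* The factor 2 is removed coefficientwise, over the integers. *)
by move/coef_nnegP/(_ m); rewrite mcoeffMn pmulrn_lge0.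
Qed.

(** The partition of the product of elementary functions that the monomial stands for; variable i
    represents e_(i+1). *)
Definition mnm_parts n (m : 'X_{1..n}) : seq nat :=
  sort geq (flatten [seq nseq (m i) i.+1 | i <- enum 'I_n]).

Lemma mnm_partsP n (m : 'X_{1..n}) : is_intpart (mnm_parts m).
Proof.
rewrite /is_intpart sort_sorted /=; last by move=> i j; exact: leq_total.
rewrite mem_sort; apply/flatten_mapP => -[i _].
by rewrite mem_nseq andbF.
Qed.

Definition mnm_intpart n (m : 'X_{1..n}) : intpart := exist is_intpart _ (mnm_partsP m).

Lemma elem_symfun_mnm n (m : 'X_{1..n}) N :
  elem_symfun (mnm_intpart m) N = 'X_[m] \mPo elem_tuple n N.
Proof.
rewrite comp_mpolyX /elem_symfun /= (perm_big _ (permEl (perm_sort _ _))) /=.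
rewrite big_flatten big_map big_enum /=; apply: eq_bigr => i _.
by rewrite big_nseq iter_mulr_1 tnth_mktuple.
Qed.

Lemma e_positive_formal (G : sgraph) n (p : {mpoly int[n]}) :
  (forall m, 0 <= p@_m) ->
  (forall N, chromatic_symfun G N = p \mPo elem_tuple n N) -> e_positive G.
Proof.
move=> p_ge0 GE.
(* Each partition collects the coefficients of all monomials mapped to it; sums keep them
   nonnegative. *)
pose c (l : intpart) : int := \sum_(m <- msupp p | mnm_intpart m == l) p@_m.
pose s : {fset intpart} := [fset l | l in map (@mnm_intpart n) (msupp p)]%fset.
exists [fsfun l in s => c l | 0]; split=> [N|l]; last first.
  by rewrite fsfunE; case: ifP => // _; apply: sumr_ge0.
set d := [fsfun _ in _ => _ | _].
(* The support may be smaller than [s]; the additional terms have coefficient 0. *)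
have -> : \sum_(l <- finsupp d) d l *: elem_symfun l N
    = \sum_(l <- s) c l *: elem_symfun l N.
  transitivity (\sum_(l <- s) d l *: elem_symfun l N).
    apply: big_fset_incl => [|l ls]; first exact: finsupp_sub.
    by rewrite memNfinsupp => /eqP ->; rewrite scale0r.
  by rewrite !big_seq; apply: eq_bigr => l ls; rewrite fsfunE ls.
rewrite GE (mpolyE p) raddf_sum /=.
under [RHS]eq_bigr => l _ do rewrite scaler_suml.
rewrite (exchange_big_dep predT) //= !big_seq; apply: eq_bigr => m mp.
rewrite comp_mpolyZ -elem_symfun_mnm.
rewrite [RHS]big_mkcond (bigD1_seq (mnm_intpart m)) /= ?eqxx.
- by rewrite big1 ?addr0 // => l; rewrite eq_sym => /negbTE ->.
- by apply/imfsetP; exists (mnm_intpart m); rewrite //= map_f.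
- exact: fset_uniq.
Qed.

End FormalExpansion.

Theorem theorem1p1 (b : nat) : e_positive (trinacria (b + 2) b 2).
Proof.
(* The number 2b + 7 of vertices, which bounds the indices of the e_i that occur, so no truncated
   formal element enters. *)
pose n := (b.+1 + b.+4.+2)%N.
apply: (@e_positive_formal _ n (trinacria_paths (formal_elem n) b)) => [m|N].
  exact: formal_trinacria_ge0.
rewrite chromatic_trinacria; symmetry; apply: trinacria_paths_morph => i ni.
exact: formal_elemE.
Qed.
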